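(* Let $R$ be an arbitrary (not necessarily commutative) ring with unity and let $P:R\to[0,1]$ be a non-constant fuzzy ideal of $R$. The following are equivalent: (a) $P$ is prime, i.e. $\inf_{r\in R}P(xry)=\max\{P(x),P(y)\}$ for all $x,y\in R$. (b) The level cut $P_\alpha$ is a prime ideal of $R$ for every $\alpha$ with $P(0)\ge\alpha>P(1)$. (c) The quotient $R/P_\alpha$ is a prime ring for every $\alpha$ with $P(0)\ge\alpha>P(1)$. (d) For any fuzzy ideal $I$ of $R$ and any $x,y\in R$: if $I(xry)\le P(xry)$ for all $r\in R$, then $I(x)\le P(x)$ or $I(y)\le P(y)$. Moreover, if $R$ is commutative, any of these statements is equivalent to $P$ being D4-prime, i.e. to the condition that for all $x,y\in R$, $P(xy)=P(x)$ or $P(xy)=P(y)$.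
   Context: Let $R$ be a ring with unity. A (two-sided) fuzzy ideal of $R$ is a map $I:R\to[0,1]$ such that for all $x,y\in R$: $I(x-y)\ge\min\{I(x),I(y)\}$ and $I(xy)\ge\max\{I(x),I(y)\}$. Consequently $I(0)$ is the maximum and $I(1)$ the minimum of $I$. For $\alpha\le I(0)$, the $\alpha$-cut (level cut) is $I_\alpha=\{x\in R: I(x)\ge\alpha\}$; it is a two-sided ideal of $R$. A proper two-sided ideal $Q$ of $R$ is prime if, for any two-sided ideals $A,B$ of $R$, $AB\subseteq Q$ implies $A\subseteq Q$ or $B\subseteq Q$; equivalently, for $x,y\in R$, $xRy\subseteq Q$ implies $x\in Q$ or $y\in Q$. A ring is prime if its zero ideal is prime. *)

(* Defs.v *)
From HB Require Import structures.
From mathcomp Require Import all_boot all_order all_algebra ring_quotient.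
From mathcomp Require Import all_classical all_reals.

Set Implicit Arguments.
Unset Strict Implicit.
Unset Printing Implicit Defensive.

Import Order.TTheory GRing.Theory Num.Theory.
Local Open Scope classical_set_scope.
Local Open Scope ring_scope.
Local Open Scope quotient_scope.

Definition two_sided_ideal (R : pzRingType) (A : set R) : Prop :=
  [/\ A 0,
      forall x y, A x -> A y -> A (x - y),
      forall r x, A x -> A (r * x) &
      forall r x, A x -> A (x * r)].

(* The product of ideals consists of all finite sums of products, not only of
   the products themselves. *)
Definition ideal_mul (R : pzRingType) (A B : set R) : set R :=
  [set z | exists (n : nat) (a b : 'I_n -> R),
     [/\ forall i, A (a i), forall i, B (b i) & z = \sum_(i < n) a i * b i]].

Definition prime_ideal (R : pzRingType) (Q : set R) : Prop :=
  [/\ two_sided_ideal Q,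
      Q <> [set: R] &
      forall A B : set R, two_sided_ideal A -> two_sided_ideal B ->
        ideal_mul A B `<=` Q -> A `<=` Q \/ B `<=` Q].

(* [set 0] is proper exactly when R is not the trivial ring. *)
Definition prime_ring (R : pzRingType) : Prop := prime_ideal [set (0 : R)].

(* MathComp's ring_quotient equips the quotient of a noncommutative ring with
   its additive structure only; the multiplication is added below. *)
Record idealType (R : pzRingType) := IdealType {
  ideal_set : set R;
  ideal_setP : two_sided_ideal ideal_set }.

Definition ideal_mem (R : pzRingType) (I : idealType R) : R -> bool :=
  fun x => x \in ideal_set I.

Lemma ideal_mem_zmod_closed (R : pzRingType) (I : idealType R) :
  zmod_closed (ideal_mem I).
Proof.
have [I0 IB _ _] := ideal_setP I.
split; first by rewrite unfold_in; exact/mem_set.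
move=> x y; rewrite !unfold_in => /set_mem Ix /set_mem Iy.
by apply/mem_set/IB.
Qed.

HB.instance Definition _ (R : pzRingType) (I : idealType R) :=
  GRing.isZmodClosed.Build R (ideal_mem I) (ideal_mem_zmod_closed I).

Definition ideal_quotient (R : pzRingType) (I : idealType R) : Type :=
  Quotient.quot (GRing.ZmodClosed.clone R (ideal_mem I) _).

Section IdealQuotient.
Variables (R : pzRingType) (I : idealType R).
Local Notation Q := (ideal_quotient I).

HB.instance Definition _ := GRing.Zmodule.on Q.
HB.instance Definition _ := Quotient.on Q.

Definition quotient_one : Q := \pi_Q 1.
Definition quotient_mul (u v : Q) : Q := \pi_Q (repr u * repr v).

Lemma ideal_quotient_eqP (x y : R) : \pi_Q x = \pi_Q y <-> ideal_set I (x - y).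
Proof.
have E := Quotient.idealrBE (GRing.ZmodClosed.clone R (ideal_mem I) _) x y.
split=> [/eqP e|h]; first by apply/set_mem; move: E; rewrite e unfold_in.
by apply/eqP; rewrite -E unfold_in; apply/mem_set.
Qed.

Lemma ideal_quotient_piM (x y : R) :
  \pi_Q (x * y) = quotient_mul (\pi_Q x) (\pi_Q y).
Proof.
have [_ IB IMl IMr] := ideal_setP I.
have D z : ideal_set I (z - repr (\pi_Q z)).
  by apply/ideal_quotient_eqP; rewrite reprK.
apply/ideal_quotient_eqP; set x' := repr (\pi_Q x); set y' := repr (\pi_Q y).
have -> : x * y - x' * y' = x * (y - y') - (x' - x) * y'.
  by rewrite mulrBr mulrBl opprB addrA subrK.
apply: IB; first exact/IMl/D.
by apply/IMr/ideal_quotient_eqP; rewrite reprK.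
Qed.

Lemma ideal_quotient_piD (x y : R) : \pi_Q (x + y) = \pi_Q x + \pi_Q y.
Proof.
exact: (Quotient.pi_add (GRing.ZmodClosed.clone R (ideal_mem I) _) x y).
Qed.

Lemma ideal_quotient_mulA : associative quotient_mul.
Proof.
move=> u v w; rewrite -[u]reprK -[v]reprK -[w]reprK.
move: (repr u) (repr v) (repr w) => x y z.
rewrite -(ideal_quotient_piM y z) -(ideal_quotient_piM x y).
by rewrite -(ideal_quotient_piM x (y * z)) -(ideal_quotient_piM (x * y) z) mulrA.
Qed.

Lemma ideal_quotient_mul1 : left_id quotient_one quotient_mul.
Proof. by move=> u; rewrite -[u]reprK -(ideal_quotient_piM 1) mul1r. Qed.

Lemma ideal_quotient_mulr1 : right_id quotient_one quotient_mul.
Proof. by move=> u; rewrite -[u]reprK -(ideal_quotient_piM _ 1) mulr1. Qed.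

Lemma ideal_quotient_mulDl : left_distributive quotient_mul +%R.
Proof.
move=> u v w; rewrite -[u]reprK -[v]reprK -[w]reprK.
move: (repr u) (repr v) (repr w) => x y z.
rewrite -ideal_quotient_piD -(ideal_quotient_piM (x + y) z) -(ideal_quotient_piM x z) -(ideal_quotient_piM y z).
by rewrite mulrDl ideal_quotient_piD.
Qed.

Lemma ideal_quotient_mulDr : right_distributive quotient_mul +%R.
Proof.
move=> u v w; rewrite -[u]reprK -[v]reprK -[w]reprK.
move: (repr u) (repr v) (repr w) => x y z.
rewrite -ideal_quotient_piD -(ideal_quotient_piM x (y + z)) -(ideal_quotient_piM x y) -(ideal_quotient_piM x z).
by rewrite mulrDr ideal_quotient_piD.
Qed.

HB.instance Definition _ := GRing.Zmodule_isPzRing.Build Q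
  ideal_quotient_mulA ideal_quotient_mul1 ideal_quotient_mulr1
  ideal_quotient_mulDl ideal_quotient_mulDr.

End IdealQuotient.

Definition fuzzy_ideal (R : pzRingType) (K : realType) (I : R -> K) : Prop :=
  [/\ forall x, 0 <= I x <= 1,
      forall x y, Num.min (I x) (I y) <= I (x - y) &
      forall x y, Num.max (I x) (I y) <= I (x * y)].

Definition level_cut (R : pzRingType) (K : realType) (I : R -> K) (alpha : K) :
    set R :=
  [set x | alpha <= I x].

Lemma level_cut_two_sided_ideal (R : pzRingType) (K : realType) (I : R -> K)
    (alpha : K) :
  fuzzy_ideal I -> alpha <= I 0 -> two_sided_ideal (level_cut I alpha).
Proof.
move=> [_ IB IM] a0; split=> //= [x y ax ay|r x ax|r x ax].
- by apply: le_trans (IB x y); rewrite le_min ax ay.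
- by apply: le_trans (IM r x); rewrite le_max ax orbT.
- by apply: le_trans (IM x r); rewrite le_max ax.
Qed.

Definition level_cut_ideal (R : pzRingType) (K : realType) (I : R -> K)
    (hI : fuzzy_ideal I) (alpha : K) (h0 : alpha <= I 0) : idealType R :=
  IdealType (level_cut_two_sided_ideal hI h0).

Definition fuzzy_prime (R : pzRingType) (K : realType) (P : R -> K) : Prop :=
  forall x y : R,
    inf [set P (x * r * y) | r in [set: R]] = Num.max (P x) (P y).

Definition D4_prime (R : pzRingType) (K : realType) (P : R -> K) : Prop :=
  forall x y : R, P (x * y) = P x \/ P (x * y) = P y.

(* Main.v *)
Require Import Defs.
From mathcomp Require Import all_boot all_order all_algebra.
From mathcomp Require Import all_classical all_reals.

Set Implicit Arguments.
Unset Strict Implicit.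
Unset Printing Implicit Defensive.

Import Order.TTheory GRing.Theory Num.Theory.
Local Open Scope ring_scope.

(** For a fuzzy ideal [P] the inequality [max (P x) (P y) <= P (x r y)] always
    holds, so primeness only asserts that the infimum is no larger than the
    maximum.  Read through its lower bounds, this says that every [m] with
    [m <= P (x r y)] for all [r] satisfies [m <= P x] or [m <= P y]
    ([fuzzy_primeP]).  All the conditions are instances of this one.

    - For levels [m] in the range from [P 1] (excluded) to [P 0], it is the
      elementwise primeness of the level cut at [m]; levels outside the range
      are harmless, since [P 1] is the minimum of [P] and [P 0 = P (x 0 y)].
      Elementwise primeness is equivalent to primeness in terms of ideals
      ([prime_idealP]) and transfers to the quotient ring along the
      projection ([prime_ring_quotientP]).
    - The comparison with other fuzzy ideals [I] follows by taking
      [m = max (I x) (I y)]; conversely it is enough to test it on the constant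
      fuzzy ideals with value [m].
    - In a commutative ring [P (x r y) >= P (x y)], so the lower bounds [m] are
      those of the single value [P (x y)]. *)

(** * Prime ideals and prime quotients *)

(** From ideals to elements, the classical proof uses the ideals generated by
    [x] and [y].  Annihilators modulo [Q] do the same without sums of products:
    [B], the elements [b] with [x R b] inside [Q], and [A], the elements [a]
    with [a R B] inside [Q], are ideals with [A B] inside [Q], [x] in [A] and
    [y] in [B]. *)
Lemma prime_idealP (R : pzRingType) (Q : set R) :
  two_sided_ideal Q ->
  prime_ideal Q <->
    ~ Q 1 /\ forall x y, (forall r, Q (x * r * y)) -> Q x \/ Q y.
Proof.
move=> idQ; have [Q0 QB QMl QMr] := idQ.
split=> [[_ properQ primeQ]|[Q1 primeQ]]; split=> //.
- move=> Q1; apply: properQ; apply/seteqP; split=> // x _.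
  by rewrite -[x]mulr1; apply: QMl.
- move=> x y xRy.
  pose B : set R := [set b | forall r, Q (x * r * b)]%classic.
  pose A : set R := [set a | forall b r, B b -> Q (a * r * b)]%classic.
  have idB : two_sided_ideal B.
    split=> [r|b c Bb Bc r|s b Bb r|s b Bb r] /=.
    + by rewrite mulr0.
    + by rewrite mulrBr; apply: QB.
    + by rewrite mulrA -[x * r * s]mulrA; apply: Bb.
    + by rewrite mulrA; apply: QMr.
  have idA : two_sided_ideal A.
    split=> [b r _|a c Aa Ac b r Bb|s a Aa b r Bb|s a Aa b r Bb] /=.
    + by rewrite !mul0r.
    + by rewrite !mulrBl; apply: QB; [apply: Aa|apply: Ac].
    + by rewrite -!mulrA; apply: QMl; rewrite mulrA; apply: Aa.
    + by rewrite -[a * s * r]mulrA; apply: Aa.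
  case: (primeQ A B idA idB).
  + move=> _ [n [a [b [Aa Bb ->]]]].
    elim/big_ind: _ => // [u v Qu Qv|i _].
      by rewrite -[v]opprK -[- v]sub0r; apply: (QB _ _ Qu); apply: QB.
    by rewrite -[a i]mulr1; apply: Aa.
  + by move=> AQ; left; apply: AQ => b r; apply.
  + by move=> BQ; right; apply: BQ.
- by move=> QT; apply: Q1; rewrite QT.
- move=> A B [_ _ _ AMr] _ ABQ.
  have [AQ|/existsNP[a /not_implyP[Aa Qa]]] := pselect (A `<=` Q)%classic.
    by left.
  right=> b Bb; have [r|//|//] := primeQ a b.
  apply: ABQ; exists 1%N, (fun=> a * r), (fun=> b); split=> //.
    by move=> _; apply: AMr.
  by rewrite big_ord1.
Qed.

Lemma zero_ideal (R : pzRingType) : two_sided_ideal [set (0 : R)]%classic.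
Proof.
split=> //= [x y -> ->|r x ->|r x ->]; first by rewrite subr0.
  by rewrite mulr0.
by rewrite mul0r.
Qed.

Lemma ideal_quotient_pi_eq0 (R : pzRingType) (I : idealType R) (x : R) :
  \pi_(ideal_quotient I)%qT x = 0 <-> ideal_set I x.
Proof.
have pi0 : \pi_(ideal_quotient I)%qT 0 = 0.
  by apply: (addrI (\pi_(ideal_quotient I)%qT 0)); rewrite -ideal_quotient_piD !addr0.
by rewrite -pi0 ideal_quotient_eqP subr0.
Qed.

(** The projection is onto and its kernel is [I], so the elementwise conditions
    for [0] in the quotient and for [I] in [R] translate into each other. *)
Lemma prime_ring_quotientP (R : pzRingType) (I : idealType R) :
  prime_ring (ideal_quotient I) <-> prime_ideal (ideal_set I).
Proof.
rewrite /prime_ring (prime_idealP (zero_ideal _)) (prime_idealP (ideal_setP I)).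
have piM x r y : \pi_(ideal_quotient I)%qT (x * r * y) =
    \pi_(ideal_quotient I)%qT x * \pi_(ideal_quotient I)%qT r
      * \pi_(ideal_quotient I)%qT y by rewrite !ideal_quotient_piM.
split=> -[proper prime]; split.
- by move/ideal_quotient_pi_eq0.
- move=> x y xRy.
  rewrite -!ideal_quotient_pi_eq0; apply: prime => s.
  by rewrite -[s]reprK -piM; apply/ideal_quotient_pi_eq0.
- by move/(ideal_quotient_pi_eq0 I 1).
- move=> u v; rewrite -[u]reprK -[v]reprK => uRv.
  rewrite /= !ideal_quotient_pi_eq0; apply: prime => r.
  by apply/ideal_quotient_pi_eq0; rewrite piM; apply: uRv.
Qed.

(** * Prime fuzzy ideals *)

Section FuzzyPrime.
Variables (R : pzRingType) (K : realType) (P : R -> K).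
Hypothesis hP : fuzzy_ideal P.

Lemma fuzzy_ideal_mul_ge (x y : R) : Num.max (P x) (P y) <= P (x * y).
Proof. by case: hP. Qed.

Lemma fuzzy_ideal_sandwich_ge (x r y : R) :
  Num.max (P x) (P y) <= P (x * r * y).
Proof.
have := fuzzy_ideal_mul_ge x r; have := fuzzy_ideal_mul_ge (x * r) y.
rewrite !ge_max => /andP[xr_le ->] /andP[x_le _].
by rewrite (le_trans x_le xr_le).
Qed.

Lemma fuzzy_ideal_ge_one (x : R) : P 1 <= P x.
Proof. by have := fuzzy_ideal_mul_ge 1 x; rewrite mul1r ge_max => /andP[]. Qed.

(** A real number is bounded by the infimum exactly when it is a lower bound.
    Quantifying over all real [m], even negative ones, keeps infima and range
    conditions out of the later arguments. *)
Lemma fuzzy_primeP :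
  fuzzy_prime P <->
    forall (m : K) (x y : R),
      (forall r, m <= P (x * r * y)) -> m <= P x \/ m <= P y.
Proof.
pose S x y := [set P (x * r * y) | r in [set: R]]%classic.
have S_neq0 x y : (S x y !=set0)%classic by exists (P (x * 0 * y)), 0.
split=> [primeP m x y m_le|primeP x y].
  apply/orP; rewrite -le_max -primeP; apply: lb_le_inf (S_neq0 x y) _.
  by move=> _ [r _ <-].
apply/le_anti/andP; split.
  rewrite le_max; apply/orP; apply: primeP => r.
  apply: ge_inf; last by exists r.
  by exists (Num.max (P x) (P y)) => _ [s _ <-]; apply: fuzzy_ideal_sandwich_ge.
apply: lb_le_inf (S_neq0 x y) _ => _ [r _ <-].
exact: fuzzy_ideal_sandwich_ge.
Qed.

(** Lower bounds [m] of [P] on [x R y] never exceed [P 0], as [x 0 y = 0], and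
    those with [m <= P 1] are below every value of [P]; so only the levels of
    proper cuts impose a condition. *)
Lemma fuzzy_prime_level_cutP :
  fuzzy_prime P <->
    forall alpha : K, alpha <= P 0 -> P 1 < alpha ->
      prime_ideal (level_cut P alpha).
Proof.
rewrite fuzzy_primeP; split=> [primeP m m0 m1|cutP m x y m_le].
  apply/(prime_idealP (level_cut_two_sided_ideal hP m0)).
  by split=> [|x y]; [rewrite /level_cut /= leNgt m1|apply: primeP].
have [m1|m1] := leP m (P 1).
  by left; apply: le_trans m1 (fuzzy_ideal_ge_one x).
have m0 : m <= P 0 by have := m_le 0; rewrite mulr0 mul0r.
have /(prime_idealP (level_cut_two_sided_ideal hP m0))[_] := cutP m m0 m1.
exact.
Qed.

Lemma fuzzy_prime_quotientP :
  fuzzy_prime P <->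
    forall (alpha : K) (h0 : alpha <= P 0), P 1 < alpha ->
      prime_ring (ideal_quotient (level_cut_ideal hP h0)).
Proof.
rewrite fuzzy_prime_level_cutP; split=> primeP m m0 m1.
  by apply/prime_ring_quotientP; apply: primeP.
exact/(prime_ring_quotientP (level_cut_ideal hP m0))/primeP.
Qed.

(** A fuzzy ideal [I] below [P] on [x R y] makes [max (I x) (I y)] a lower bound
    of [P] there; a given lower bound [m] is recovered from the constant [I]. *)
Lemma fuzzy_prime_idealwiseP :
  fuzzy_prime P <->
    forall (I : R -> K), fuzzy_ideal I -> forall x y : R,
      (forall r : R, I (x * r * y) <= P (x * r * y)) -> I x <= P x \/ I y <= P y.
Proof.
rewrite fuzzy_primeP; split=> [primeP I [_ _ IM] x y IP|primeP m x y m_le].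
  have [r||] := primeP (Num.max (I x) (I y)) x y.
  - apply: le_trans (IP r).
    have := IM (x * r) y; have := IM x r; rewrite !ge_max.
    by move=> /andP[x_le _] /andP[xr_le ->]; rewrite (le_trans x_le xr_le).
  - by rewrite ge_max => /andP[]; left.
  - by rewrite ge_max => /andP[]; right.
have [P01 _ _] := hP.
(* The constant map with value m has values in [0, 1] only when m >= 0. *)
have [m_ge0|m_lt0] := leP 0 m; last first.
  by left; apply: le_trans (ltW m_lt0) _; have /andP[] := P01 x.
apply: (primeP (fun=> m)) => //; split=> [_|_ _|_ _].
- by rewrite m_ge0; apply: le_trans (m_le 0) _; have /andP[] := P01 (x * 0 * y).
- by rewrite minxx.
- by rewrite maxxx.
Qed.

Lemma fuzzy_prime_D4P :
  (forall x y : R, x * y = y * x) -> fuzzy_prime P <-> D4_prime P.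
Proof.
move=> comR; rewrite fuzzy_primeP; split=> [primeP x y|D4 m x y m_le].
  have /andP[x_le y_le] : (P x <= P (x * y)) && (P y <= P (x * y)).
    by rewrite -ge_max fuzzy_ideal_mul_ge.
  have [r||] := primeP (P (x * y)) x y.
  - rewrite [x * r]comR -mulrA.
    by have := fuzzy_ideal_mul_ge r (x * y); rewrite ge_max => /andP[].
  - by move=> le_x; left; apply/le_anti; rewrite le_x.
  - by move=> le_y; right; apply/le_anti; rewrite le_y.
have := m_le 1; rewrite mulr1.
by have [->|->] := D4 x y; [left|right].
Qed.

End FuzzyPrime.

Theorem proposition4p2 (R : pzRingType) (K : realType) (P : R -> K)
    (hP : fuzzy_ideal P) (hnc : exists x y : R, P x <> P y) :
  [/\ fuzzy_prime P <->
        (forall alpha : K, alpha <= P 0 -> P 1 < alpha ->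
           prime_ideal (level_cut P alpha)),
      fuzzy_prime P <->
        (forall (alpha : K) (h0 : alpha <= P 0), P 1 < alpha ->
           prime_ring (ideal_quotient (level_cut_ideal hP h0))),
      fuzzy_prime P <->
        (forall (I : R -> K), fuzzy_ideal I -> forall x y : R,
           (forall r : R, I (x * r * y) <= P (x * r * y)) ->
           I x <= P x \/ I y <= P y) &
      (forall x y : R, x * y = y * x) ->
        (fuzzy_prime P <-> D4_prime P)].
Proof.
split.
- exact: fuzzy_prime_level_cutP.
- exact: fuzzy_prime_quotientP.
- exact: fuzzy_prime_idealwiseP.
- exact: fuzzy_prime_D4P.
Qed.
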